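(* There is an absolute constant $C>0$ such that for every positive integer $n$, the $2$-colour size-Ramsey number of the $3$-uniform tight path on $n$ vertices satisfies $\hat{r}_2(P^{(3)}_n)\le Cn$; that is, $\hat{r}_2(P^{(3)}_n)=O(n)$.
   Context: For hypergraphs $G$ and $H$ and an integer $s$, write $G\rightarrow (H)_s$ if in every colouring of the edges of $G$ with $s$ colours there is a monochromatic copy of $H$. The $s$-colour size-Ramsey number is $\hat{r}_s(H)=\min\{|E(G)| : G\rightarrow (H)_s\}$. The $3$-uniform tight path $P^{(3)}_n$ is the $3$-uniform hypergraph on vertices $x_1,\dots,x_n$ whose edges are the triples $\{x_i,x_{i+1},x_{i+2}\}$ for $1\le i\le n-2$. *)

(* Defs.v *)
From mathcomp Require Import all_boot.
Set Implicit Arguments. Unset Strict Implicit. Unset Printing Implicit Defensive.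

Definition uniform3 (V : finType) (E : {set {set V}}) : Prop :=
  forall e, e \in E -> #|e| = 3.

Definition tight_path_copy (V : finType) (E : {set {set V}}) (n : nat)
    (f : nat -> V) : Prop :=
  (forall i j, i < n -> j < n -> f i = f j -> i = j) /\
  (forall i, i.+2 < n -> [set f i; f i.+1; f i.+2] \in E).

Definition monochromatic_path (V : finType) (s : nat) (c : {set V} -> 'I_s)
    (n : nat) (f : nat -> V) : Prop :=
  exists col : 'I_s, forall i, i.+2 < n -> c [set f i; f i.+1; f i.+2] = col.

(* G = (V,E) -> (P^(3)_n)_s : every s-colouring of the edges of G has a
   monochromatic copy of P^(3)_n. (Colourings are functions on all vertex
   sets; only their values on edges matter.) *)
Definition arrows_tight_path (V : finType) (E : {set {set V}}) (s n : nat) : Prop :=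
  forall c : {set V} -> 'I_s,
    exists f : nat -> V, tight_path_copy E n f /\ monochromatic_path c n f.

(* Main.v *)
Require Import Defs.
From mathcomp Require Import all_boot.
From mathcomp Require Import zify.
Set Implicit Arguments. Unset Strict Implicit. Unset Printing Implicit Defensive.

(* Let H be a bounded-degree graph on 8n vertices in which any two large sets
   span an edge (after discarding a few vertices of large degree). The host
   hypergraph is the blow-up of H by t points per vertex; its edges are the
   triples whose bases lie in a common ball of radius 2 of H (a "cell"). Given a
   2-colouring, Ramsey's theorem shrinks the fibres so that within each cell the
   colour of a triple depends only on its bases. It then suffices to find a
   monochromatic tight walk on the vertices of H, of length n, which lives in
   cells and visits each vertex boundedly often.
   Call u, v linked if some cell has a walk of colour true from u u to v v. If
   the link graph has a path on n vertices, we are done in colour true.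
   Otherwise depth-first search gives three sets A, B, C of size n without links
   between them. In a cell, all pairs joining different sets among A, B, C are
   then connected in colour false. By expansion H has a path z_1, ..., z_n
   whose vertices all have neighbours a_i, b_i, c_i in A, B, C; moving from
   a_i b_i to the pair of the next index inside the cell of z_i yields a long
   walk of colour false. *)

(** * Ramsey's theorem, greedy colouring, depth-first search *)

Lemma pigeonhole_seq (A : eqType) (K : finType) (g : A -> K) (m : nat)
    (s : seq A) :
  #|K| * m < size s -> exists k : K, m < size [seq x <- s | g x == k].
Proof.
move=> lt_s; apply/existsP; apply: contraLR lt_s => /existsPn small.
have -> : size s = \sum_(k : K) size [seq x <- s | g x == k].
  rewrite -{1}(count_predT s) -sum1_count (partition_big g predT) //=.
  by apply: eq_bigr => k _; rewrite size_filter -sum1_count.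
rewrite -leqNgt -sum_nat_const; apply: leq_sum => k _.
by rewrite leqNgt small.
Qed.

(** By induction on [r]: [pre] extracts a subsequence on which the colour of a tuple depends only on
    its first entry, and pigeonholing the entries by that colour finishes. *)
Lemma ramsey (r : nat) (K : finType) (m : nat) :
  exists T : nat, forall (A : eqType) (c : seq A -> K) (s : seq A),
    T <= size s ->
    exists s' : seq A, [/\ subseq s' s, size s' = m &
      exists k : K, forall t, size t = r -> subseq t s' -> c t = k].
Proof.
elim: r m => [|r IHr] m.
  exists m => A c s le_m; exists (take m s); split.
  - exact: take_subseq.
  - by rewrite size_takel.
  by exists (c [::]) => t /size0nil ->.
have pre p : exists T : nat, forall (A : eqType) (c : seq A -> K) (s : seq A),
    T <= size s -> exists s' : seq A, [/\ subseq s' s, size s' = p &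
      exists g : A -> K, forall a t, size t = r -> subseq (a :: t) s' ->
        c (a :: t) = g a].
  elim: p => [|p [Tp IHp]].
    exists 1 => A c [//|a s] _; exists [::]; split; rewrite ?sub0seq //.
    by exists (fun=> c [:: a]).
  have [T HT] := IHr Tp; exists T.+1 => A c [//|a s] /= le_s.
  have [s1 [sub1 sz1 [k Hk]]] := HT A (fun t => c (a :: t)) s le_s.
  have [s2 [sub2 sz2 [g Hg]]] := IHp A c s1 (eq_leq (esym sz1)).
  exists (a :: s2); split => /=; rewrite ?eqxx ?sz2 //.
    exact: subseq_trans sub2 sub1.
  exists (fun x => if x == a then k else g x) => x t szt /=.
  case: eqP => [-> subt|_ subt]; last exact: Hg.
  by apply: Hk => //; apply: subseq_trans sub2.
have [T HT] := pre (#|K| * m).+1; exists T => A c s le_s.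
have [s1 [sub1 sz1 [g Hg]]] := HT A c s le_s.
have [k le_k] := pigeonhole_seq g (eq_leq (esym sz1)).
have sub2 : subseq (take m [seq x <- s1 | g x == k]) [seq x <- s1 | g x == k].
  exact: take_subseq.
exists (take m [seq x <- s1 | g x == k]); split.
- by apply: subseq_trans sub2 _; apply: subseq_trans (filter_subseq _ _) sub1.
- by rewrite size_takel // ltnW.
exists k => -[//|a t] /= [szt] subt.
rewrite (Hg a t) //.
  have: a \in [seq x <- s1 | g x == k].
    by apply: (mem_subseq (subseq_trans subt sub2)); rewrite mem_head.
  by rewrite mem_filter => /andP[/eqP].
by apply: subseq_trans subt _; apply: subseq_trans sub2 (filter_subseq _ _).
Qed.

Lemma greedy_coloring (V : finType) (e : rel V) (Q : nat) :
  symmetric e -> (forall x, #|[set y | e x y]| <= Q) ->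
  exists h : V -> 'I_Q.+1, forall x y, x != y -> e x y -> h x != h y.
Proof.
move=> sym_e deg.
suff [h Hh] : exists h : V -> 'I_Q.+1, forall x y,
    x \in enum V -> y \in enum V -> x != y -> e x y -> h x != h y.
  by exists h => x y; apply: Hh; rewrite mem_enum.
elim: (enum V) => [|z s [h Hh]]; first by exists (fun=> ord0).
have [q qP] : exists q : 'I_Q.+1, q \notin [set h y | y in [set y | e z y]].
  apply/existsP; apply: contraT => /existsPn all_in.
  have: #|'I_Q.+1| <= #|[set h y | y in [set y | e z y]]|.
    by apply/subset_leq_card/subsetP => q _; have := all_in q; rewrite negbK.
  by rewrite card_ord leqNgt ltnS (leq_trans (leq_imset_card _ _) (deg z)).
have qN y : e z y -> q != h y.
  by move=> ezy; apply: contraNneq qP => ->; apply: imset_f; rewrite inE.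
exists (fun x => if x == z then q else h x) => x y.
rewrite !inE; case: (altP (x =P z)) => [->|xz] /=;
  case: (altP (y =P z)) => [->|yz] //= xs ys xy exy.
- by rewrite eqxx in xy.
- exact: qN.
- by rewrite eq_sym qN // sym_e.
- exact: Hh.
Qed.

(** Depth-first search: [p] is the stack, [D] the exhausted vertices, [U] the unvisited ones, and no
    edge goes from [D] to [U]. If the stack is still shorter than [n] when [D] reaches size [s],
    then at least [s] vertices are left in [U]. *)
Lemma long_path_or_gap (V : finType) (e : rel V) (W : {set V}) (n s : nat) :
  n + s.*2 <= #|W| ->
  (exists p : seq V, [/\ size p = n, uniq p, {subset p <= W} & sorted e p]) \/
  (exists X Y : {set V}, [/\ X \subset W, Y \subset W, s <= #|X|, s <= #|Y| &
      forall x y, x \in X -> y \in Y -> ~~ e x y]).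
Proof.
set goal := (X in _ -> X); move=> leW.
suff step k : forall (p : seq V) (D U : {set V}),
    (* Pushing a vertex lowers this measure by one, and so does popping. *)
    #|U|.*2 + size p <= k ->
    (forall x, (x \in W) = [|| x \in p, x \in D | x \in U]) ->
    #|W| = size p + #|D| + #|U| -> {in D, forall x, x \notin U} ->
    uniq p -> {in p, forall x, (x \notin D) && (x \notin U)} ->
    size p <= n -> #|D| <= s ->
    {in D & U, forall x y, ~~ e x y} -> sorted e (rev p) -> goal.
  apply: (step _ [::] set0 W (leqnn _)) => //.
  - by move=> x; rewrite !inE.
  - by rewrite cards0.
  - by move=> x; rewrite inE.
  - by rewrite cards0.
  - by move=> x y; rewrite inE.
elim: k => [|k IH] p D U lek defW cardW disDU uniq_p disp le_p leD noe path_p.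
all: have [eq_p|ne_p] := eqVneq (size p) n;
  first by left; exists (rev p); split; rewrite ?size_rev ?rev_uniq // => x;
    rewrite mem_rev defW => ->.
all: have [leD'|ltD] := leqP s #|D|;
  first by right; exists D, U; split => //;
   [apply/subsetP => x; rewrite defW => ->; rewrite ?orbT|
    apply/subsetP => x; rewrite defW => ->; rewrite ?orbT|
    clear -leD cardW leW le_p; lia].
  by exfalso; clear -lek ltD cardW leW le_p; lia.
have push y : y \in U -> sorted e (rev (y :: p)) -> goal.
  move=> yU path_yp; have cardU := cardsD1 y U; rewrite yU in cardU.
  apply: (IH (y :: p) D (U :\ y)) => //=.
  - clear -cardU lek; lia.
  - move=> x; rewrite defW !inE; case: (eqVneq x y) => [->|_] //=.
    by rewrite yU !orbT.
  - clear -cardU cardW; lia.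
  - by move=> x xD; rewrite !inE (negPf (disDU x xD)) andbF.
  - rewrite uniq_p andbT; apply/negP => /disp; by rewrite yU andbF.
  - move=> x; rewrite !inE; case: (eqVneq x y) => [-> _|_ /= /disp] //=.
    by rewrite andbT; apply/negP => /disDU; rewrite yU.
  - clear -le_p ne_p; lia.
  - by move=> x z xD; rewrite inE => /andP[_]; apply: noe.
case: p => [|x p] in push lek defW cardW uniq_p disp le_p ne_p path_p *.
  have /card_gt0P[y yU] : 0 < #|U|.
    by move: cardW => /= cardW; clear -cardW leW ltD; lia.
  exact: (push y).
have [/existsP[y /andP[yU exy]]|/existsPn no_y] :=
  boolP [exists y, (y \in U) && e x y].
  apply: (push y) => //; rewrite rev_cons.
  move: path_p; rewrite rev_cons; case: (rev p) => [|z q] /=; first by rewrite exy.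
  by rewrite !rcons_path last_rcons exy andbT.
move: uniq_p => /= /andP[xp uniq_p].
have /andP[xD xU] := disp x (mem_head _ _).
have cardD : #|x |: D| = #|D|.+1 by rewrite cardsU1 xD.
apply: (IH p (x |: D) U) => //; rewrite ?cardD.
- move: lek => /= lek; clear -lek; lia.
- by move=> y; rewrite defW !inE orbA (orbC (y == x)) -!orbA.
- by rewrite cardW /= addSnnS.
- by move=> y; rewrite !inE => /orP[/eqP->|/disDU].
- move=> y yp; have := disp y; rewrite !inE yp orbT => /(_ isT) /andP[/negPf-> ->].
  by rewrite orbF andbT; apply: contraNneq xp => <-.
- exact: ltnW.
- exact: ltD.
- move=> a b; rewrite !inE => /orP[/eqP->|]; last exact: noe.
  by move=> bU; have := no_y b; rewrite bU.
move: path_p; rewrite rev_cons; case: (rev p) => [|z q] //=.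
by rewrite rcons_path => /andP[].
Qed.

(** * Tight walks in a single cell *)

(* A walk of pairs (a, b) -> (b, c) -> ... encodes the tight walk a, b, c, ...
   in the reduced structure, in which vertices may repeat. *)
Definition pair_step (V : finType) (chi : V -> V -> V -> bool) (C : {set V})
    (b : bool) : rel (V * V) :=
  fun p q => [&& q.1 == p.2, p.1 \in C, p.2 \in C, q.2 \in C &
                chi p.1 p.2 q.2 == b].

Definition symmetric3 (V : finType) (chi : V -> V -> V -> bool) : Prop :=
  (forall a b c, chi a b c = chi b a c) /\ (forall a b c, chi a b c = chi a c b).

Lemma connect_swap (V : finType) (chi : V -> V -> V -> bool) (C : {set V})
    (b : bool) (p q : V * V) :
  symmetric3 chi -> connect (pair_step chi C b) p q ->
  connect (pair_step chi C b) (q.2, q.1) (p.2, p.1).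
Proof.
move=> [s12 s23] /connectP[t]; elim: t p => [|[y z] t IH] [u v] /=.
  by move=> _ ->.
move=> /andP[/and5P[/= /eqP-> uC vC zC chi_b]] path_t last_t.
apply: connect_trans (IH _ path_t last_t) (connect1 _).
by rewrite /pair_step /= uC vC zC eqxx s12 s23 s12.
Qed.

(** The true triples with a repeated vertex let a walk leave x x and enter y y. In the four cases
    the walks are x x y y, x x y x z y y, x x z y x y y and x x z y y. *)
Lemma linked_of_blue (V : finType) (chi : V -> V -> V -> bool) (C : {set V})
    (x y z : V) :
  symmetric3 chi -> x \in C -> y \in C -> z \in C -> chi x y z ->
  chi x x y || chi x x z -> chi y y x || chi y y z ->
  connect (pair_step chi C true) (x, x) (y, y).
Proof.
move=> [s12 s23] xC yC zC xyz.
have st a b c : a \in C -> b \in C -> c \in C -> chi a b c ->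
    forall q, connect (pair_step chi C true) (b, c) q ->
    connect (pair_step chi C true) (a, b) q.
  move=> aC bC cC abc q; apply: connect_trans; apply: connect1.
  by rewrite /pair_step /= aC bC cC abc eqxx.
have xzy : chi x z y by rewrite s23.
have yxz : chi y x z by rewrite s12.
have zyx : chi z y x by rewrite s12 s23 s12.
case/orP=> hx; case/orP=> hy.
- by apply: (st x x y) => //; apply: (st x y y) => //; rewrite s12 s23.
- apply: (st x x y) => //; apply: (st x y x) => //; first by rewrite s23.
  apply: (st y x z) => //; apply: (st x z y) => //; apply: (st z y y) => //.
  by rewrite s12 s23.
- apply: (st x x z) => //; apply: (st x z y) => //; apply: (st z y x) => //.
  apply: (st y x y) => //; first by rewrite s23.
  by apply: (st x y y) => //; rewrite s12 s23.
- apply: (st x x z) => //; apply: (st x z y) => //; apply: (st z y y) => //.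
  by rewrite s12 s23.
Qed.

(** If u v u has colour true, then u v v has colour false, as otherwise the walk u u v v would link
    the two vertices; the walk is then u v v u. *)
Lemma red_connect_flip (V : finType) (chi : V -> V -> V -> bool) (C : {set V})
    (u v : V) :
  symmetric3 chi -> u \in C -> v \in C ->
  ~~ connect (pair_step chi C true) (u, u) (v, v) ->
  connect (pair_step chi C false) (u, v) (v, u).
Proof.
move=> [s12 s23] uC vC nl.
have [uuv|uuv] := boolP (chi u u v); last first.
  by apply: connect1; rewrite /pair_step /= uC vC eqxx s23 (negPf uuv).
have [uvv|uvv] := boolP (chi u v v).
  case/negP: nl; apply: (connect_trans (y := (u, v))); apply: connect1;
  by rewrite /pair_step /= uC vC eqxx ?uuv ?uvv.
apply: (connect_trans (y := (v, v))); apply: connect1;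
by rewrite /pair_step /= uC vC eqxx ?(s23 v v u) ?(s12 v u v) (negPf uvv).
Qed.

(* If u, v, w are pairwise not linked in colour true, then either u v w has
   colour false, or at most one of its vertices x is in a triple x x y of colour
   true with y in the triangle (two such vertices would be linked), so that two
   of them have only false triples of this kind. *)
Lemma red_connect_triangle (V : finType) (chi : V -> V -> V -> bool)
    (C : {set V}) (u v w : V) :
  symmetric3 chi -> u \in C -> v \in C -> w \in C ->
  ~~ connect (pair_step chi C true) (u, u) (v, v) ->
  ~~ connect (pair_step chi C true) (u, u) (w, w) ->
  ~~ connect (pair_step chi C true) (v, v) (w, w) ->
  connect (pair_step chi C false) (u, v) (u, w).
Proof.
move=> sym uC vC wC nuv nuw nvw; have [s12 s23] := sym.
have st a b c : a \in C -> b \in C -> c \in C -> ~~ chi a b c ->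
    forall q, connect (pair_step chi C false) (b, c) q ->
    connect (pair_step chi C false) (a, b) q.
  move=> aC bC cC abc q; apply: connect_trans; apply: connect1.
  by rewrite /pair_step /= aC bC cC (negPf abc) eqxx.
have flip_wu : connect (pair_step chi C false) (w, u) (u, w).
  apply: red_connect_flip => //; apply: contra nuw => /(connect_swap sym).
  by [].
have [uvw|uvw] := boolP (chi u v w); last first.
  by apply: (st u v w) => //; apply: (st v w u) => //; rewrite s23 s12.
have Nuv := contra (linked_of_blue sym uC vC wC uvw _) nuv.
have uwv : chi u w v by rewrite s23.
have vwu : chi v w u by rewrite s23 s12.
(* Either [u] has only false triples and the walk is u v u u w, or [v] and [w] have only false ones
   and the walk is u v v w w u, followed by [flip_wu]. *)
have [hu|] := boolP (chi u u v || chi u u w); last first.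
  rewrite negb_or => /andP[uuv uuw].
  apply: (st u v u) => //; first by rewrite s23.
  apply: (st v u u) => //; first by rewrite s12 s23.
  exact: (st u u w).
have [hv|] := boolP (chi v v u || chi v v w).
  by case/negP: nuv; apply: linked_of_blue uvw _ _.
rewrite negb_or => /andP[vvu vvw].
have [hw|] := boolP (chi w w u || chi w w v).
  by case/negP: nuw; apply: linked_of_blue uwv _ _; rewrite // orbC.
rewrite negb_or => /andP[wwu wwv].
apply: (st u v v) => //; first by rewrite s12 s23.
apply: (st v v w) => //.
apply: (st v w w) => //; first by rewrite s12 s23.
exact: (st w w u).
Qed.

(* The segments are shortened to repetition-free walks of pairs, which visit each
   vertex of a cell at most D times. *)
Lemma connect_concat (V : finType) (chi : V -> V -> V -> V -> bool)
    (cell : V -> {set V}) (b : bool) (D n : nat) (s : nat -> V * V)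
    (x : nat -> V) :
  (forall y, #|cell y| <= D) ->
  (forall i, i < n -> connect (pair_step (chi (x i)) (cell (x i)) b) (s i) (s i.+1)) ->
  (forall i, i < n -> s i != s i.+1) ->
  exists p : seq (V * V), [/\
    path (fun q r => [exists y, pair_step (chi y) (cell y) b q r]) (s 0) p,
    n <= size p, last (s 0) p = s n &
    forall v, count (fun q => q.1 == v) p <= \sum_(i < n) (v \in cell (x i)) * D].
Proof.
move=> cellD; elim: n => [|n IH] conn neq.
  by exists [::]; split => // v; rewrite big_ord0.
have [||p [path_p sz_p last_p cnt_p]] := IH.
- by move=> i lt_i; apply: conn; apply: ltnW.
- by move=> i lt_i; apply: neq; apply: ltnW.
have /connectP[q0 path_q0 last_q0] := conn n (ltnSn n).
move: last_q0; case: (shortenP path_q0) => q path_q uniq_q _ last_q.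
exists (p ++ q); split.
- rewrite cat_path path_p last_p /=; apply: sub_path path_q => q1 q2 h.
  by apply/existsP; exists (x n).
- rewrite size_cat; case: q last_q {path_q uniq_q} => [/= h|? ? _ /=].
    by have := neq n (ltnSn n); rewrite h eqxx.
  by rewrite addnS ltnS (leq_trans sz_p) // leq_addr.
- by rewrite last_cat last_p -last_q.
move=> v; rewrite count_cat big_ord_recr /= leq_add //.
have inC r : r \in q -> (r.1 \in cell (x n)) && (r.2 \in cell (x n)).
  elim: q (s n) path_q {uniq_q last_q} => [//|a q IHq] t /=.
  case/andP=> /and5P[/eqP a1 _ t2 a2 _] /IHq{}IHq.
  by rewrite inE => /orP[/eqP->|//]; rewrite a1 t2 a2.
have [vC|vC] := boolP (v \in cell (x n)); last first.
  rewrite mul0n leqn0 -leqn0 leqNgt -has_count; apply/hasPn => r /inC /andP[r1 _].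
  by apply: contraNneq vC => <-.
rewrite mul1n -size_filter (leq_trans _ (cellD (x n))) //.
have /andP[_ uq] := uniq_q.
(* Distinct pairs with first vertex [v] have distinct second vertices, all in the cell. *)
have <- : size [seq r.2 | r <- [seq r <- q | r.1 == v]]
        = size [seq r <- q | r.1 == v] by rewrite size_map.
have /card_uniqP <- : uniq [seq r.2 | r <- [seq r <- q | r.1 == v]].
  rewrite map_inj_in_uniq ?filter_uniq // => -[a1 a2] [b1 b2].
  by rewrite !mem_filter /= => /andP[/eqP-> _] /andP[/eqP-> _] ->.
apply/subset_leq_card/subsetP => y /mapP[r].
by rewrite mem_filter => /andP[_ /inC/andP[_ ?]] ->.
Qed.

(** * Expanders *)

(** Bernoulli's inequality; [d] is chosen so that the linear term d m^(d-1) equals (K+1) m^d. *)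
Lemma exp_gap (K m : nat) : 0 < m -> exists d, 0 < d /\ K * m ^ d < m.+1 ^ d.
Proof.
move=> m0; exists (m * K.+1); split; first by rewrite muln_gt0 m0.
have bern d : m ^ d + d * m ^ d.-1 <= m.+1 ^ d.
  case: d => [//|d]; elim: d => [|d IH]; first by rewrite /= !expn1 expn0; lia.
  rewrite [X in _ <= X]expnS; apply: leq_trans (leq_mul (leqnn _) IH).
  rewrite /= !expnS; nia.
apply: leq_trans (bern _).
have [q defq] : exists q, m * K.+1 = q.+1.
  by exists (m * K.+1).-1; rewrite prednK // muln_gt0 m0.
have e : q.+1 * m ^ q = K.+1 * m ^ q.+1.
  by rewrite expnS -defq mulnA (mulnC K.+1).
rewrite defq /= e mulSn; have : 0 < m ^ q.+1 by rewrite expn_gt0 m0.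
lia.
Qed.

(* Union bound: a random function misses Y from X with probability at most
   (7/8)^(d n), and there are 4^(8 n) pairs (X, Y). *)
Lemma expanding_functions : exists d, 0 < d /\ forall n, 0 < n ->
  exists f : {ffun 'I_d * 'I_(8 * n) -> 'I_(8 * n)},
  forall X Y : {set 'I_(8 * n)}, n <= #|X| -> n <= #|Y| ->
  exists i x, (x \in X) && (f (i, x) \in Y).
Proof.
(* The number 4^(8n) of pairs is (2^16)^n, so (8/7)^d must exceed 2^16. *)
have [d [d0 gap]] := @exp_gap (2 ^ 16) 7 isT; exists d; split => // n n0.
set N := 8 * n.
have lew a b k : a <= b -> a ^ k <= b ^ k.
  by case: k => [//|k] le_ab; rewrite leq_exp2r.
pose bad (X Y : {set 'I_N}) (f : {ffun 'I_d * 'I_N -> 'I_N}) :=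
  [forall q, (q.2 \in X) ==> (f q \notin Y)].
(* This is (7n)^(dn) (8n)^(7dn), with the powers of [n] collected so that they cancel against the
   total number N^(dN) of functions. *)
have card_bad (X Y : {set 'I_N}) : n <= #|X| -> n <= #|Y| ->
    #|[set f | bad X Y f]| <= 7 ^ (d * n) * 8 ^ (7 * n * d) * n ^ (8 * n * d).
  move=> leX leY.
  have -> : #|[set f | bad X Y f]| =
     #|family (fun q : 'I_d * 'I_N => mem (if q.2 \in X then ~: Y else setT))|.
    apply: eq_card => f; rewrite inE; apply/forallP/familyP => h q;
      have := h q; case: (q.2 \in X) => //=; rewrite ?inE //.
  rewrite card_family foldrE big_map big_enum /=.
  have cX : #|[set q : 'I_d * 'I_N | q.2 \in X]| = d * #|X|.
    have -> : [set q : 'I_d * 'I_N | q.2 \in X] = setX setT X.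
      by apply/setP => -[i y]; rewrite !inE.
    by rewrite cardsX cardsT card_ord.
  have leXN : #|X| <= N by rewrite (leq_trans (max_card _)) ?card_ord.
  rewrite (bigID (fun q => q.2 \in X)) /=.
  rewrite (eq_bigr (fun=> N - #|Y|)); last first.
    move=> q -> /=; transitivity #|~: Y|; first exact: eq_card.
    by rewrite cardsCs setCK card_ord.
  rewrite [X in _ * X](eq_bigr (fun=> N)); last first.
    move=> q /negPf-> /=; transitivity #|'I_N|; last exact: card_ord.
    by apply: eq_card => y; rewrite !inE.
  rewrite !prod_nat_const.
  have -> : #|(fun q : 'I_d * 'I_N => q.2 \in X)| = d * #|X|.
    by rewrite -cX; apply: eq_card => q; rewrite inE.
  have -> : #|(fun q : 'I_d * 'I_N => q.2 \notin X)| = d * (N - #|X|).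
    have := cardsC [set q : 'I_d * 'I_N | q.2 \in X].
    rewrite cX card_prod !card_ord => eqC.
    rewrite mulnBr -eqC addKn.
    by apply: eq_card => q; rewrite !inE.
  have h1 : N - #|Y| <= 7 * n.
    by have /(_ _ leY) : forall y, n <= y -> 8 * n - y <= 7 * n by lia.
  apply: leq_trans (leq_mul (lew _ _ _ h1) (leqnn _)) _.
  rewrite /N !expnMn mulnACA -expnD -mulnDr subnKC //.
  rewrite (_ : d * (8 * n) = 8 * n * d) ?leq_mul2r; last by rewrite mulnC.
  apply/orP; right.
  have -> : d * #|X| = d * n + d * (#|X| - n) by rewrite -mulnDr subnKC.
  rewrite expnD -mulnA leq_mul2l; apply/orP; right.
  apply: leq_trans (leq_mul (lew _ _ _ (_ : 7 <= 8)) (leqnn _)) _ => //.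
  rewrite -expnD leq_pexp2l // -mulnDr mulnC leq_mul2r; apply/orP; right.
  by move: leXN leX; rewrite /N; move: #|X|; lia.
suff [f Hf] : exists f, [forall X : {set 'I_N}, forall Y : {set 'I_N},
    (n <= #|X|) && (n <= #|Y|) ==> ~~ bad X Y f].
  exists f => X Y leX leY; move/forallP/(_ X)/forallP/(_ Y): Hf.
  rewrite leX leY /= => /forallPn[[i y]]; rewrite negb_imply negbK => h.
  by exists i, y.
apply/existsP; apply: contraT => /existsPn all_bad; exfalso.
have : #|{ffun 'I_d * 'I_N -> 'I_N}| <=
   \sum_(XY : {set 'I_N} * {set 'I_N}) 7 ^ (d * n) * 8 ^ (7 * n * d) * n ^ (8 * n * d).
  rewrite -sum1_card.
  apply: (@leq_trans (\sum_(f : {ffun 'I_d * 'I_N -> 'I_N})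
     \sum_(XY : {set 'I_N} * {set 'I_N} | (n <= #|XY.1|) && (n <= #|XY.2|))
        bad XY.1 XY.2 f)).
    apply: leq_sum => f _; have /forallPn[X /forallPn[Y]] := all_bad f.
    rewrite negb_imply negbK => /andP[le_n badf].
    by rewrite (bigD1 (X, Y)) //= badf.
  rewrite exchange_big /= [X in _ <= X](bigID (fun XY : {set 'I_N} * {set 'I_N} =>
    (n <= #|XY.1|) && (n <= #|XY.2|))) /=.
  apply: leq_trans (leq_addr _ _); apply: leq_sum => XY /andP[leX leY].
  apply: leq_trans (card_bad _ _ leX leY).
  rewrite -sum1_card big_mkcond [X in _ <= X]big_mkcond.
  by apply: leq_sum => f _; rewrite inE.
have card_setN : #|{: {set 'I_N}}| = 2 ^ N.
  by rewrite -cardsT -powersetT card_powerset cardsT card_ord.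
rewrite sum_nat_const card_prod !card_setN card_ffun card_prod !card_ord.
rewrite leqNgt; case/negP.
have -> : 2 ^ N * 2 ^ N = (2 ^ 16) ^ n by rewrite -expnD -expnM /N; congr (_ ^ _); lia.
have -> : N ^ (d * N) = (8 ^ d) ^ n * 8 ^ (7 * n * d) * n ^ (8 * n * d).
  rewrite /N expnMn -expnM -expnD; congr (_ ^ _ * _ ^ _); lia.
rewrite mulnA ltn_mul2r expn_gt0 n0 /= mulnA ltn_mul2r expn_gt0 /=.
by rewrite expnM -expnMn ltn_exp2r.
Qed.

(* G discards the at most n vertices of in-degree more than 8 d. *)
Lemma expander : exists D, forall n, 0 < n ->
  exists (e : rel 'I_(8 * n)) (G : {set 'I_(8 * n)}),
  [/\ symmetric e, forall x, #|[set y | e x y]| <= D, 7 * n <= #|G| &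
   forall X Y : {set 'I_(8 * n)}, X \subset G -> Y \subset G ->
     n <= #|X| -> n <= #|Y| -> exists x y, [/\ x \in X, y \in Y & e x y]].
Proof.
have [d [d0 Hd]] := expanding_functions; exists (d + 8 * d) => n n0.
have [f Hf] := Hd n n0.
pose G := [set v | #|[set q | f q == v]| <= 8 * d].
pose a x y := [exists i, f (i, x) == y].
exists (fun x y => [&& x \in G, y \in G & a x y || a y x]), G; split.
- by move=> x y; rewrite andbCA orbC.
- move=> x; have [xG|xG] := boolP (x \in G); last first.
    apply: (@leq_trans 0) => //; rewrite leqn0 cards_eq0.
    by apply/eqP/setP => y; rewrite !inE.
  pose A := [set f (i, x) | i : 'I_d].
  pose B := [set q.2 | q in [set q | f q == x]].
  apply: (@leq_trans #|A :|: B|).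
    apply/subset_leq_card/subsetP => y; rewrite !inE.
    case/and3P=> _ _ /orP[] /existsP[i /eqP h].
      by apply/orP; left; apply/imsetP; exists i.
    by apply/orP; right; apply/imsetP; exists (i, y); rewrite ?inE ?h.
  apply: leq_trans (leq_card_setU _ _) _; apply: leq_add.
    by rewrite (leq_trans (leq_imset_card _ _)) // card_ord.
  by rewrite (leq_trans (leq_imset_card _ _)) //; rewrite inE in xG.
- have tot : \sum_v #|[set q | f q == v]| = d * (8 * n).
    rewrite -[d in RHS]card_ord -[in RHS](card_ord (8 * n)) -card_prod -sum1_card.
    rewrite (partition_big f predT) //=; apply: eq_bigr => v _.
    by rewrite -sum1_card; apply: eq_bigl => q; rewrite inE.
  (* The in-degrees sum to 8dn, and each discarded vertex accounts for more than 8d of it. *)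
  have : #|~: G| * (8 * d) <= d * (8 * n).
    rewrite -tot -sum_nat_const [X in _ <= X](bigID (mem (~: G))) /=.
    apply: leq_trans (leq_addr _ _); apply: leq_sum => v.
    by rewrite !inE -ltnNge => /ltnW.
  rewrite (mulnC #|_|) (mulnCA d) (mulnA 8) leq_pmul2l; last by rewrite muln_gt0.
  have := cardsC G; rewrite card_ord; move: #|G| #|~: G|; clear; lia.
move=> X Y XG YG leX leY; have [i [x /andP[xX fY]]] := Hf X Y leX leY.
exists x, (f (i, x)); split => //.
apply/and3P; split; [exact: (subsetP XG)|exact: (subsetP YG)|].
by apply/orP; left; apply/existsP; exists i.
Qed.

(** * Making the colouring depend on bases only *)

(* The colour of three points (v, i) of the blow-up with bases in the cell C
   and i in the retained set S v depends only on the three bases, which need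
   not be distinct. *)
Definition homogeneous_cell (V : finType) (t : nat) (c : {set V * 'I_t} -> bool)
    (S : V -> seq 'I_t) (C : {set V}) (chi : V -> V -> V -> bool) : Prop :=
  symmetric3 chi /\
  forall p q r : V * 'I_t, p.1 \in C -> q.1 \in C -> r.1 \in C ->
    p.2 \in S p.1 -> q.2 \in S q.1 -> r.2 \in S r.1 -> uniq [:: p; q; r] ->
    c [set p; q; r] = chi p.1 q.1 r.1.

Lemma card_cover_leq (I T : finType) (P : {set I}) (F : I -> {set T})
    (A : {set T}) (k : nat) :
  (forall i, i \in P -> #|F i| <= k) ->
  (forall y, y \in A -> exists2 i, i \in P & y \in F i) -> #|A| <= #|P| * k.
Proof.
move=> leF cov; apply: (@leq_trans (\sum_y \sum_(i in P) (y \in F i))).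
  rewrite -sum1_card big_mkcond /=; apply: leq_sum => y _.
  by case: ifP => // /cov[i iP yF]; rewrite (bigD1 i) //= yF.
rewrite exchange_big -sum_nat_const; apply: leq_sum => i /leF; apply: leq_trans.
by rewrite -sum1_card [X in _ <= X]big_mkcond; apply: leq_sum.
Qed.

Lemma subseq_map_nth (A : eqType) (a : A) (s : seq A) (l : seq nat) :
  sorted ltn l -> all (ltn^~ (size s)) l -> subseq (map (nth a s) l) s.
Proof.
move=> sorted_l lt_l; rewrite -[X in subseq _ X](mkseq_nth a s) map_subseq //.
have -> : l = [seq i <- iota 0 (size s) | i \in l].
  apply: (irr_sorted_eq ltn_trans ltnn) => //.
    by rewrite sorted_filter ?iota_ltn_sorted //; apply: ltn_trans.
  move=> i; rewrite mem_filter mem_iota /= add0n.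
  by case: (boolP (i \in l)) => //= /(allP lt_l) /= ->.
exact: filter_subseq.
Qed.

(* All fibres over C are identified with one set of indices; Ramsey's theorem
   colours i < j < k by the list of colours of the triples
   (a, i), (b, j), (c, k) with a, b, c in C. Giving disjoint chunks of the
   homogeneous set to the vertices of C makes the order of the indices
   irrelevant. *)
Lemma clean_cell (D m : nat) : 0 < m -> exists T : nat,
  forall (V : finType) (t : nat) (c : {set V * 'I_t} -> bool) (C : {set V})
    (S : V -> seq 'I_t),
  #|C| <= D -> (forall v, uniq (S v)) -> (forall v, T <= size (S v)) ->
  exists S' chi, [/\ forall v, v \in C -> uniq (S' v),
    forall v, v \in C -> {subset S' v <= S v},
    forall v, v \in C -> m <= size (S' v) & homogeneous_cell c S' C chi].
Proof.
move=> m0; pose K := {ffun 'I_D.+1 * 'I_D.+1 * 'I_D.+1 -> bool}.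
(* [D * m] indices give a chunk of [m] to each of at most [D] vertices; the successor in [T.+1]
   guarantees a default element [t0]. *)
have [T HT] := ramsey 3 K (D * m); exists T.+1 => V t c C S leC uniqS leS.
have [C0|[v0 v0C]] := set_0Vmem C.
  exists S, (fun _ _ _ => true); split; try by move=> v; rewrite C0 inE.
  by split=> // p q r; rewrite C0 inE.
have [t0 _] : exists t0, t0 \in S v0.
  by case: (S v0) (leS v0) => // t0 s; exists t0; rewrite mem_head.
pose en := enum C; pose pt a i := (nth v0 en a, nth t0 (S (nth v0 en a)) i).
pose kappa (l : seq nat) : K := [ffun a : 'I_D.+1 * 'I_D.+1 * 'I_D.+1 =>
  c [set pt a.1.1 (nth 0 l 0); pt a.1.2 (nth 0 l 1); pt a.2 (nth 0 l 2)]].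
have [s [sub_s size_s [g Hg]]] := HT _ kappa (iota 0 T) (eq_leq (esym (size_iota 0 T))).
have s_lt i : i < D * m -> nth 0 s i < T.
  move=> lti; have : nth 0 s i \in iota 0 T.
    by apply: (mem_subseq sub_s); rewrite mem_nth ?size_s.
  by rewrite mem_iota.
have uniq_s : uniq s by apply: subseq_uniq sub_s (iota_uniq _ _).
pose h (l : seq nat) :=
  g (inord (nth 0 l 0), inord (nth 0 l 1), inord (nth 0 l 2)).
(* Sorting the positions makes [chi] symmetric. Since chunks are classes of the monotone map
   [i %/ m], sorting the indices of three points also sorts the positions of their bases. *)
pose chi u v w := h (sort leq [:: index u en; index v en; index w en]).
pose chunk a := [seq i <- iota 0 (D * m) | i %/ m == a].
pose S' v := [seq nth t0 (S v) (nth 0 s i) | i <- chunk (index v en)].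
have size_en : size en <= D by rewrite -cardE.
have leST v : T <= size (S v) by apply: leq_trans (leS v).
exists S', chi; split.
- move=> v vC; rewrite map_inj_in_uniq ?filter_uniq ?iota_uniq // => i j.
  rewrite !mem_filter !mem_iota /= => /andP[_ lti] /andP[_ ltj] /eqP.
  rewrite nth_uniq ?(leq_trans (s_lt _ _)) // nth_uniq ?size_s //.
  by move/eqP.
- move=> v vC x /mapP[i]; rewrite mem_filter mem_iota /= => /andP[_ lti] ->.
  by rewrite mem_nth // (leq_trans (s_lt _ _)).
- move=> v vC; rewrite size_map.
  have ltv : index v en < D.
    by rewrite (leq_trans _ size_en) // index_mem mem_enum.
  rewrite -[m in m <= _](size_iota (index v en * m)).
  apply: uniq_leq_size => [|i]; first exact: iota_uniq.
  rewrite mem_iota mem_filter mem_iota /= add0n => /andP[h1 h2].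
  have -> : i = index v en * m + (i - index v en * m) by lia.
  rewrite divnMDl // divn_small ?addn0 ?eqxx; nia.
split.
  have hperm l1 l2 : perm_eq l1 l2 -> h (sort leq l1) = h (sort leq l2).
    by move/(perm_sortP leq_total leq_trans anti_leq) ->.
  by split=> u v w; apply: hperm; rewrite /perm_eq /= ?eqxx; lia.
have ptP p : p.1 \in C -> p.2 \in S' p.1 ->
    exists2 i, i < D * m & p = pt (i %/ m) (nth 0 s i) /\ i %/ m = index p.1 en.
  case: p => v x /= vC /mapP[i]; rewrite mem_filter mem_iota /=.
  case/andP=> /eqP eqi lti ->; exists i => //; split=> //.
  by rewrite /pt eqi nth_index // mem_enum.
move=> p q r pC qC rC pS qS rS uniq_pqr.
have [i1 lt1 [defp ip]] := ptP p pC pS.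
have [i2 lt2 [defq iq]] := ptP q qC qS.
have [i3 lt3 [defr ir]] := ptP r rC rS.
rewrite /chi -ip -iq -ir.
pose F i := pt (i %/ m) (nth 0 s i).
have uniq_i : uniq [:: i1; i2; i3].
  by apply: (@map_uniq _ _ F); rewrite /= /F -defp -defq -defr.
have -> : [set p; q; r] = [set x in map F [:: i1; i2; i3]].
  by apply/setP => x; rewrite !inE -orbA /F -defp -defq -defr.
pose l := sort leq [:: i1; i2; i3].
have perm_l : perm_eq l [:: i1; i2; i3] by rewrite perm_sort.
have -> : [set x in map F [:: i1; i2; i3]] = [set x in map F l].
  by apply/setP => x; rewrite !in_set; apply: perm_mem; rewrite perm_map // perm_sym.
have -> : sort leq [:: i1 %/ m; i2 %/ m; i3 %/ m] = map (divn^~ m) l.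
  rewrite -(sorted_sort leq_trans (s := map (divn^~ m) l)).
    apply/(perm_sortP leq_total leq_trans anti_leq).
    by rewrite perm_sym (perm_map (divn^~ m) perm_l).
  have: sorted leq l := sort_sorted leq_total _.
  by rewrite sorted_map; apply: sub_sorted => x y /=; apply: leq_div2r.
have sorted_l : sorted ltn l.
  by rewrite ltn_sorted_uniq_leq sort_uniq uniq_i (sort_sorted leq_total).
have lt_l : all (ltn^~ (D * m)) l.
  by rewrite (perm_all _ perm_l) /= lt1 lt2 lt3.
have : size l = 3 by rewrite size_sort.
have div_l i : i \in l -> (inord (i %/ m) : 'I_D.+1) = i %/ m :> nat.
  move=> il; have /= : i < D * m := allP lt_l i il.
  by rewrite -ltn_divLR // => lti; apply: inordK; apply: leq_trans lti _.
case: l sorted_l lt_l div_l {perm_l} => [|j1 [|j2 [|j3 [|]]]] // sorted_l lt_l div_l _.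
have := Hg [:: nth 0 s j1; nth 0 s j2; nth 0 s j3] erefl _.
rewrite -[[:: _; _; _]]/(map (nth 0 s) [:: j1; j2; j3]).
rewrite subseq_map_nth // ?size_s // => /(_ isT).
move/ffunP/(_ (inord (j1 %/ m), inord (j2 %/ m), inord (j3 %/ m))).
rewrite /h /= => <-; rewrite ffunE /=; congr c.
by apply/setP => x; rewrite !inE -orbA /F !div_l // !inE eqxx ?orbT.
Qed.

(* Cells of the same round h are disjoint, so a round shrinks each fibre once. *)
Lemma clean_rounds (D k M : nat) : 0 < M -> exists T : nat,
  forall (V : finType) (t : nat) (c : {set V * 'I_t} -> bool)
    (cell : V -> {set V}) (h : V -> nat) (S : V -> seq 'I_t),
  (forall x, #|cell x| <= D) ->
  (forall x y, x != y -> h x = h y -> [disjoint cell x & cell y]) ->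
  (forall v, uniq (S v)) -> (forall v, T <= size (S v)) ->
  exists S' chi, [/\ forall v, uniq (S' v), forall v, {subset S' v <= S v},
    forall v, M <= size (S' v) &
    forall x, h x < k -> homogeneous_cell c S' (cell x) (chi x)].
Proof.
elim: k M => [|k IH] M M0.
  exists M => V t c cell h S cellD disj uniqS leS.
  by exists S, (fun _ _ _ _ => true); split=> // v x.
have [T1 H1] := clean_cell D M0.
(* [T1] serves the fibres shrunk in this round, [M] those left alone. *)
have [T H] := IH (maxn T1 M) (leq_trans M0 (leq_maxr _ _)).
exists T => V t c cell h S cellD disj uniqS leS.
have [S1 [chi1 [uniq1 sub1 size1 hom1]]] := H V t c cell h S cellD disj uniqS leS.
have sz1 v : T1 <= size (S1 v) by apply: leq_trans (size1 v); apply: leq_maxl.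
have /fin_all_exists[S2 /fin_all_exists[chi2 H2]] x :=
  H1 V t c (cell x) S1 (cellD x) uniq1 sz1.
(* Disjointness leaves at most one candidate [x]. Shrinking the fibres keeps the cells of earlier
   rounds homogeneous. *)
pose S' v := if [pick x | (h x == k) && (v \in cell x)] is Some x
             then S2 x v else S1 v.
have S'P v : (exists x, [/\ h x = k, v \in cell x & S' v = S2 x v]) \/ S' v = S1 v.
  rewrite /S'; case: pickP => [x /andP[/eqP hx vx]|_]; last by right.
  by left; exists x.
have subS1 v : {subset S' v <= S1 v}.
  case: (S'P v) => [[x [_ vx ->]]|-> //]; by have [_ /(_ v vx)] := H2 x.
exists S', (fun x => if h x == k then chi2 x else chi1 x); split.
- by move=> v; case: (S'P v) => [[x [_ vx ->]]|-> //]; have [/(_ v vx)] := H2 x.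
- by move=> v a /subS1; apply: sub1.
- move=> v; case: (S'P v) => [[x [_ vx ->]]|->].
    by have [_ _ /(_ v vx)] := H2 x.
  by apply: leq_trans (size1 v); apply: leq_maxr.
move=> x; rewrite ltnS leq_eqVlt => /orP[/eqP hx|ltx]; last first.
  rewrite ltn_eqF //; have [sy hom] := hom1 x ltx; split=> // p q r pC qC rC pS qS rS.
  by apply: hom => //; apply: subS1.
rewrite hx eqxx; have [_ _ _ [sy hom]] := H2 x; split=> // p q r pC qC rC.
have S'E v : v \in cell x -> S' v = S2 x v.
  move=> vx; rewrite /S'; case: pickP => [y /andP[/eqP hy vy]|/(_ x)]; last first.
    by rewrite hx eqxx vx.
  have [-> //|yx] := eqVneq y x.
  by have /disjointFr/(_ vy) := disj y x yx (etrans hy (esym hx)); rewrite vx.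
by rewrite !S'E //; apply: hom.
Qed.

(** A cell meets at most [D * D] cells, so greedy colouring sorts the cells into [(D * D).+1] rounds
    of disjoint ones, a number independent of [V]. *)
Lemma clean (D M : nat) : 0 < M -> exists t : nat,
  forall (V : finType) (cell : V -> {set V}) (c : {set V * 'I_t} -> bool),
  (forall x, #|cell x| <= D) -> (forall v, #|[set x | v \in cell x]| <= D) ->
  exists S chi, [/\ forall v, uniq (S v), forall v, M <= size (S v) &
    forall x, homogeneous_cell c S (cell x) (chi x)].
Proof.
move=> M0; have [t Ht] := clean_rounds D (D * D).+1 M0.
exists t => V cell c cellD incD.
pose e x y := ~~ [disjoint cell x & cell y].
have [||h Hh] := @greedy_coloring V e (D * D).
- by move=> x y; rewrite /e disjoint_sym.
- move=> x; apply: leq_trans (leq_mul (cellD x) (leqnn D)).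
  apply: (card_cover_leq (F := fun v => [set y | v \in cell y])) => // y.
  by rewrite inE => /pred0Pn[v /andP[/= vx vy]]; exists v; rewrite ?inE.
have [|||S [chi [uniqS _ szS hom]]] :=
    Ht V t c cell (fun x => h x) (fun=> enum 'I_t) cellD.
- move=> x y xy /val_inj hxy; apply: contraT => exy.
  by have := Hh x y xy exy; rewrite hxy eqxx.
- by move=> v; apply: enum_uniq.
- by move=> v; rewrite size_enum_ord.
by exists S, chi; split=> // x; apply: hom.
Qed.

(** * Lifting walks to tight paths *)

Lemma connect_mem (V : finType) (chi : V -> V -> V -> bool) (C : {set V})
    (b : bool) (p q : V * V) :
  connect (pair_step chi C b) p q -> p != q -> (p.1 \in C) /\ (q.2 \in C).
Proof.
move=> /connectP[[|r t] /=]; first by move=> _ ->; rewrite eqxx.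
move=> /andP[/and5P[_ p1 _ r2 _]] path_t -> _; split=> //.
elim: t r r2 path_t {p1} => [|r' t IH] r r2 //= /andP[/and5P[_ _ _ r2' _]].
exact: IH.
Qed.

(** Doubled end vertices make walks from different cells composable: one ending in v v is continued
    by any one starting in v v. *)
Definition linked (V : finType) (chi : V -> V -> V -> bool) (C : {set V}) :
    rel V := fun u v => connect (pair_step chi C true) (u, u) (v, v).

Lemma linked_sym (V : finType) (chi : V -> V -> V -> bool) (C : {set V})
    (u v : V) : symmetric3 chi -> linked chi C u v -> linked chi C v u.
Proof. exact: connect_swap. Qed.

(** With [c] as pivot, the walk passes through the pairs a b, a c, c a, c b', b' c, b' a'. *)
Lemma red_connect_cross (V : finType) (chi : V -> V -> V -> bool) (C : {set V})
    (a b c a' b' : V) :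
  symmetric3 chi -> a \in C -> b \in C -> c \in C -> a' \in C -> b' \in C ->
  ~~ linked chi C a b -> ~~ linked chi C a c -> ~~ linked chi C b c ->
  ~~ linked chi C a b' -> ~~ linked chi C b' a' ->
  ~~ linked chi C a' c -> ~~ linked chi C b' c ->
  connect (pair_step chi C false) (a, b) (b', a').
Proof.
move=> sym aC bC cC a'C b'C nab nac nbc nab' nb'a' na'c nb'c.
have nca : ~~ linked chi C c a by apply: contra nac; apply: linked_sym.
have ncb' : ~~ linked chi C c b' by apply: contra nb'c; apply: linked_sym.
have nca' : ~~ linked chi C c a' by apply: contra na'c; apply: linked_sym.
apply: connect_trans (red_connect_triangle sym aC bC cC nab nac nbc) _.
apply: connect_trans (red_connect_flip sym aC cC nac) _.
apply: connect_trans (red_connect_triangle sym cC aC b'C nca ncb' nab') _.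
apply: connect_trans (red_connect_flip sym cC b'C ncb') _.
exact: red_connect_triangle sym b'C cC a'C nb'c nb'a' nca'.
Qed.

(** The common cell is what makes each triple an edge of the host. *)
Definition blowup_path (V : finType) (t : nat) (c : {set V * 'I_t} -> bool)
    (cell : V -> {set V}) (b : bool) (n : nat) (f : nat -> V * 'I_t) : Prop :=
  (forall i j, i < n -> j < n -> f i = f j -> i = j) /\
  (forall i, i.+2 < n -> c [set f i; f i.+1; f i.+2] = b /\
     exists x, [/\ (f i).1 \in cell x, (f i.+1).1 \in cell x
                 & (f i.+2).1 \in cell x]).

(** Successive visits to a vertex are sent to successive points of its fibre, which has room for all
    of them; homogeneity carries the colour over. *)
Lemma lift_walk (V : finType) (t n M : nat) (c : {set V * 'I_t} -> bool)
    (cell : V -> {set V}) (S : V -> seq 'I_t) (chi : V -> V -> V -> V -> bool)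
    (b : bool) (q0 : V * V) (p : seq (V * V)) :
  0 < M -> (forall v, uniq (S v)) -> (forall v, M <= size (S v)) ->
  (forall x, homogeneous_cell c S (cell x) (chi x)) ->
  path (fun q r => [exists y, pair_step (chi y) (cell y) b q r]) q0 p ->
  n <= (size p).+1 -> (forall v, count (fun q => q.1 == v) (q0 :: p) <= M) ->
  exists f, blowup_path c cell b n f.
Proof.
move=> M0 uniqS sizeS hom path_p le_n cnt.
pose w := [seq q.1 | q <- q0 :: p]; pose v i := nth q0.1 w i.
have [t0 _] : exists t0, t0 \in S q0.1.
  by case: (S q0.1) (leq_trans M0 (sizeS q0.1)) => // t0 s; exists t0; rewrite mem_head.
have size_w : size w = (size p).+1 by rewrite size_map.
pose k i := count_mem (v i) (take i w).
have k_lt i j : i < j -> j < size w -> v i = v j -> k i < k j.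
  move=> ltij ltj vij; rewrite /k -vij.
  have -> : (count_mem (v i) (take i w)).+1 = count_mem (v i) (take i.+1 w).
    rewrite (take_nth q0.1) ?(ltn_trans ltij) // -cats1 count_cat /= /v eqxx; lia.
  by rewrite -(take_takel w ltij) leq_count_subseq // take_subseq.
have k_M i : i < size w -> k i < size (S (v i)).
  move=> lti; apply: leq_trans (sizeS _); apply: leq_trans (cnt (v i)).
  have -> : count (fun q => q.1 == v i) (q0 :: p) = count_mem (v i) w.
    by rewrite count_map.
  rewrite -[in X in _ <= X](cat_take_drop i w) (drop_nth q0.1) // count_cat.
  by rewrite /= eqxx addnCA leq_addr.
pose f i := (v i, nth t0 (S (v i)) (k i)).
have f_inj i j : i < j -> j < n -> f i <> f j.
  move=> ltij ltj; have ltjw : j < size w by rewrite size_w (leq_trans ltj).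
  have ltiw := ltn_trans ltij ltjw.
  case=> vij /eqP; rewrite -vij nth_uniq ?k_M // => [/eqP kij|].
    by have := k_lt i j ltij ltjw vij; rewrite kij ltnn.
  by rewrite vij k_M.
exists f; split.
  move=> i j lti ltj fij; case: (ltngtP i j) => // lt.
    by case: (f_inj i j lt ltj).
  by case: (f_inj j i lt lti).
move=> i lti.
have lt2 : i.+1 < size p by rewrite -ltnS; apply: leq_trans le_n.
have lt1 : i < size p by apply: ltnW.
have /(pathP q0)path_nth := path_p.
have vE j : j < size (q0 :: p) -> v j = (nth q0 (q0 :: p) j).1.
  by move=> ltj; rewrite /v (nth_map q0).
(* The step at [i] provides the triple; the step at [i.+1] identifies its third vertex with
   [v i.+2]. *)
have /existsP[x1 st1] := path_nth i lt1.
have /existsP[x2 st2] := path_nth i.+1 lt2.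
have /and5P[/eqP e1 c1 c2 c3 chi1] := st1.
have /and5P[/eqP e2 _ _ _ _] := st2.
have v0E : v i = (nth q0 (q0 :: p) i).1 by apply: vE; rewrite /= ltnS ltnW.
have v1E : v i.+1 = (nth q0 (q0 :: p) i).2 by rewrite vE // -e1.
have v2E : v i.+2 = (nth q0 p i).2 by rewrite vE // -e2.
have vC : [/\ v i \in cell x1, v i.+1 \in cell x1 & v i.+2 \in cell x1].
  by rewrite v0E v1E v2E.
split; last by exists x1.
have [vC0 vC1 vC2] := vC; have [_ hc] := hom x1.
have fS j : j < size w -> (f j).2 \in S (f j).1 by move=> ltj; rewrite mem_nth ?k_M.
have ltw2 : i.+2 < size w by rewrite size_w.
have ltw1 := ltnW ltw2; have ltw0 := ltnW ltw1.
have lti1 := ltnW lti.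
have uniq_f : uniq [:: f i; f i.+1; f i.+2].
  rewrite /= !inE negb_or !andbT -andbA; apply/and3P; split; apply/eqP.
  - exact: f_inj.
  - by apply: f_inj => //; apply: ltnW.
  - exact: f_inj.
rewrite (hc (f i) (f i.+1) (f i.+2) vC0 vC1 vC2
  (fS _ ltw0) (fS _ ltw1) (fS _ ltw2) uniq_f) /=.
by rewrite v0E v1E v2E; apply/eqP.
Qed.

(** A vertex lies in at most [D] cells, each cell serves at most [D] segments, and each segment
    visits the vertex at most [D] times; the starting pair adds one visit. *)
Lemma lift_chain (V : finType) (t n D : nat) (c : {set V * 'I_t} -> bool)
    (cell : V -> {set V}) (S : V -> seq 'I_t) (chi : V -> V -> V -> V -> bool)
    (b : bool) (s : nat -> V * V) (x : nat -> V) :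
  (forall y, #|cell y| <= D) -> (forall v, #|[set y | v \in cell y]| <= D) ->
  (forall v, uniq (S v)) -> (forall v, (D * D * D).+1 <= size (S v)) ->
  (forall y, homogeneous_cell c S (cell y) (chi y)) ->
  (forall i, i.+1 < n ->
     connect (pair_step (chi (x i)) (cell (x i)) b) (s i) (s i.+1)) ->
  (forall i, i.+1 < n -> s i != s i.+1) ->
  (forall y, #|[set i : 'I_n.-1 | x i == y]| <= D) ->
  exists f, blowup_path c cell b n f.
Proof.
move=> cellD incD uniqS sizeS hom conn neq multD.
have ltP i : i < n.-1 -> i.+1 < n by case: n {conn neq multD}.
have [||p [path_p sz_p _ cnt_p]] :=
  connect_concat (s := s) (x := x) (n := n.-1) (b := b) (chi := chi) cellD.
- by move=> i /ltP; apply: conn.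
- by move=> i /ltP; apply: neq.
apply: (lift_walk (ltn0Sn _) uniqS sizeS hom path_p).
  by case: n sz_p {conn neq multD ltP cnt_p}.
move=> v /=; rewrite -add1n leq_add ?leq_b1 //; apply: leq_trans (cnt_p v) _.
rewrite -big_distrl /= leq_mul2r; apply/orP; right.
rewrite (eq_bigr (fun i : 'I_n.-1 => if v \in cell (x i) then 1 else 0));
  last by move=> i _; case: ifP.
rewrite -big_mkcond sum1dep_card /=.
apply: leq_trans (leq_mul (incD v) (leqnn D)).
apply: (card_cover_leq (F := fun y => [set i : 'I_n.-1 | x i == y])) => // i.
by rewrite inE => vi; exists (x i); rewrite inE.
Qed.

(** * The expander argument and the host hypergraph *)

Definition ball2 (V : finType) (e : rel V) (z : V) : {set V} :=
  [set y | e z y || [exists z', e z z' && e z' y]].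

Lemma card_ball2 (V : finType) (e : rel V) (k : nat) (z : V) :
  (forall x, #|[set y | e x y]| <= k) -> #|ball2 e z| <= k + k * k.
Proof.
move=> deg; have -> : ball2 e z =
    [set y | e z y] :|: [set y | [exists z', e z z' && e z' y]].
  by apply/setP => y; rewrite !inE.
apply: leq_trans (leq_card_setU _ _) _; apply: leq_add => //.
apply: leq_trans (leq_mul (deg z) (leqnn k)).
apply: (card_cover_leq (F := fun x => [set y | e x y])) => // y.
by rewrite inE => /existsP[z' /andP[h1 h2]]; exists z'; rewrite inE.
Qed.

Lemma ball2_sym (V : finType) (e : rel V) (y z : V) :
  symmetric e -> (y \in ball2 e z) = (z \in ball2 e y).
Proof.
move=> sym; rewrite !inE sym; congr orb.
by apply: eq_existsb => x; rewrite andbC !(sym x).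
Qed.

Lemma arrow_core (n D t : nat) (V : finType) (e : rel V) (G : {set V})
    (c : {set V * 'I_t} -> bool) (S : V -> seq 'I_t)
    (chi : V -> V -> V -> V -> bool) :
  0 < n -> 0 < D -> symmetric e -> (forall y, #|ball2 e y| <= D) ->
  7 * n <= #|G| ->
  (forall X Y : {set V}, X \subset G -> Y \subset G ->
     n <= #|X| -> n <= #|Y| -> exists x y, [/\ x \in X, y \in Y & e x y]) ->
  (forall v, uniq (S v)) -> (forall v, (D * D * D).+1 <= size (S v)) ->
  (forall y, homogeneous_cell c S (ball2 e y) (chi y)) ->
  exists b f, blowup_path c (ball2 e) b n f.
Proof.
move=> n0 D0 sym_e cellD cardG expand uniqS sizeS hom.
have incD v : #|[set y | v \in ball2 e y]| <= D.
  apply: leq_trans (cellD v); apply/subset_leq_card/subsetP => y.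
  by rewrite inE ball2_sym.
have symchi y : symmetric3 (chi y) by case: (hom y).
pose L u v := [exists y, linked (chi y) (ball2 e y) u v].
have ltP (i : 'I_n.-1) : i.+1 < n by case: i; case: n n0 {cardG expand}.
have blue p : size p = n -> uniq p -> sorted L p ->
    exists b f, blowup_path c (ball2 e) b n f.
  move=> size_p uniq_p path_p; exists true.
  have [v0 _] : exists v0, v0 \in p.
    case: p size_p n0 {uniq_p path_p} => [<-//|v0 p] _ _.
    by exists v0; rewrite mem_head.
  pose s i := (nth v0 p i, nth v0 p i).
  pose x i := odflt v0
    [pick y | linked (chi y) (ball2 e y) (nth v0 p i) (nth v0 p i.+1)].
  have xP i : i.+1 < n ->
      linked (chi (x i)) (ball2 e (x i)) (nth v0 p i) (nth v0 p i.+1).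
    move=> lti; rewrite /x; case: pickP => [//|none].
    have /(sortedP v0)/(_ i) := path_p; rewrite size_p => /(_ lti)/existsP[y].
    by rewrite none.
  have neq i : i.+1 < n -> s i != s i.+1.
    move=> lti; apply/eqP => -[/eqP]; rewrite nth_uniq ?size_p //; last exact: ltnW.
    by rewrite (ltn_eqF (ltnSn i)).
  apply: (lift_chain (s := s) (x := x) cellD incD uniqS sizeS hom) => // y.
  (* A cell serving the segment [i] contains the [i]-th vertex of [p], and these vertices are
     distinct, so it serves at most [D] segments. *)
  rewrite -(card_in_imset (f := fun i : 'I_n.-1 => nth v0 p i)); last first.
    move=> i j _ _ /eqP; rewrite nth_uniq ?size_p ?(ltnW (ltP _)) //.
    by move/eqP/val_inj.
  apply: leq_trans (cellD y); apply/subset_leq_card/subsetP => v /imsetP[i].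
  rewrite inE => /eqP <- ->.
  by have [] := connect_mem (xP i (ltP i)) (neq i (ltP i)).
(* The first search splits off two unlinked sets of size [3 * n]; the second finds [B] and [C]
   inside one of them. *)
have [|[p [szp up _ sp]]|[A [Y [AG YG leA leY nAY]]]] :=
  @long_path_or_gap V L G n (3 * n).
- by clear -cardG; lia.
- exact: blue szp up sp.
have [|[p [szp up _ sp]]|[B [C [BY CY leB leC nBC]]]] :=
  @long_path_or_gap V L Y n n.
- by clear -leY; lia.
- exact: blue szp up sp.
have [BG CG] := (subset_trans BY YG, subset_trans CY YG).
have nAB a b : a \in A -> b \in B -> ~~ L a b.
  by move=> aA /(subsetP BY); apply: nAY.
have nAC a d : a \in A -> d \in C -> ~~ L a d.
  by move=> aA /(subsetP CY); apply: nAY.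
have {}leA : n <= #|A| by clear -leA; lia.
(* By expansion each of the three exceptional sets has fewer than [n] vertices, so enough of [G]
   remains for a search along [e], where a gap is impossible. *)
pose far (X : {set V}) := [set z in G | [forall y in X, ~~ e z y]].
have far_lt (X : {set V}) : X \subset G -> n <= #|X| -> #|far X| < n.
  move=> XG leX; rewrite ltnNge; apply/negP => lefar.
  have [|z [y [zf yX ezy]]] := expand (far X) X _ XG lefar leX.
    by apply/subsetP => z; rewrite inE => /andP[].
  by move: zf; rewrite inE => /andP[_ /forallP/(_ y)]; rewrite yX ezy.
pose Z := G :\: (far A :|: far B :|: far C).
have leZ : n + n.*2 <= #|Z|.
  have := cardsID (far A :|: far B :|: far C) G; rewrite -/Z.
  have := subset_leq_card (subsetIr G (far A :|: far B :|: far C)).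
  have := leq_of_leqif (leq_card_setU (far A :|: far B) (far C)).
  have := leq_of_leqif (leq_card_setU (far A) (far B)).
  have := far_lt A AG leA; have := far_lt B BG leB; have := far_lt C CG leC.
  clear -cardG; lia.
have ZG : Z \subset G by apply: subsetDl.
have [p [szp up pZ sp]] : exists p : seq V,
    [/\ size p = n, uniq p, {subset p <= Z} & sorted e p].
  have [//|[X [Y' [XZ YZ leX leY' nXY]]]] := @long_path_or_gap V e Z n n leZ.
  have [x [y [xX yY exy]]] :=
    expand X Y' (subset_trans XZ ZG) (subset_trans YZ ZG) leX leY'.
  by have := nXY x y xX yY; rewrite exy.
have near (X : {set V}) z : z \in G -> z \notin far X -> exists2 y, y \in X & e z y.
  rewrite inE => -> /= /forallPn[y]; rewrite negb_imply negbK => /andP[yX ezy].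
  by exists y.
have [v0 _] : exists v0, v0 \in p.
  by case: p szp n0 {up pZ sp} => [<-//|v0 p] _ _; exists v0; rewrite mem_head.
pose pt (X : {set V}) i := odflt v0 [pick y in X | e (nth v0 p i) y].
have ptP X i : (forall z, z \in Z -> z \notin far X) -> i < n ->
    pt X i \in X /\ e (nth v0 p i) (pt X i).
  move=> ZX lti; have zZ : nth v0 p i \in Z by rewrite pZ // mem_nth ?szp.
  rewrite /pt; case: pickP => [y /andP[] //|none].
  have [y yX ezy] := near X _ (subsetP ZG _ zZ) (ZX _ zZ).
  by have := none y; rewrite yX ezy.
have ZA z : z \in Z -> z \notin far A.
  by case/setDP=> _; rewrite !in_setU !negb_or -andbA => /and3P[].
have ZB z : z \in Z -> z \notin far B.
  by case/setDP=> _; rewrite !in_setU !negb_or -andbA => /and3P[].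
have ZC z : z \in Z -> z \notin far C.
  by case/setDP=> _; rewrite !in_setU !negb_or -andbA => /and3P[].
(* The order alternates because [red_connect_cross] exchanges the sides [A] and [B]. *)
pose s i := if odd i then (pt B i, pt A i) else (pt A i, pt B i).
exists false; apply: (lift_chain (s := s) (x := fun i => nth v0 p i)
  cellD incD uniqS sizeS hom).
- move=> i lti; have lti0 := ltnW lti.
  set z := nth v0 p i; have ezz' : e z (nth v0 p i.+1).
    by have /(sortedP v0)/(_ i) := sp; rewrite szp => /(_ lti).
  have cell0 y : e z y -> y \in ball2 e z by rewrite inE => ->.
  (* Radius 2 is chosen for this: the cell of a path vertex contains the neighbours of the next
     one. *)
  have cell1 y : e (nth v0 p i.+1) y -> y \in ball2 e z.
    by move=> h; rewrite inE; apply/orP; right; apply/existsP;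
       exists (nth v0 p i.+1); rewrite ezz'.
  have nl u v : ~~ L u v -> ~~ linked (chi z) (ball2 e z) u v.
    by apply: contra => h; apply/existsP; exists z.
  have nl' u v : ~~ L u v -> ~~ linked (chi z) (ball2 e z) v u.
    by move/nl; apply: contra; apply: linked_sym.
  have [aA /cell0 aC] := ptP A i ZA lti0; have [bB /cell0 bC] := ptP B i ZB lti0.
  have [cC /cell0 cC'] := ptP C i ZC lti0.
  have [aA1 /cell1 aC1] := ptP A i.+1 ZA lti.
  have [bB1 /cell1 bC1] := ptP B i.+1 ZB lti.
  rewrite /s /=; case: (odd i) => /=.
    by apply: (red_connect_cross (c := pt C i)) => //;
      first [by apply: nl; auto | by apply: nl'; auto].
  by apply: (red_connect_cross (c := pt C i)) => //;
    first [by apply: nl; auto | by apply: nl'; auto].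
- move=> i lti; have lti0 := ltnW lti.
  have [aA _] := ptP A i ZA lti0; have [bB _] := ptP B i ZB lti0.
  have [aA1 _] := ptP A i.+1 ZA lti; have [bB1 _] := ptP B i.+1 ZB lti.
  (* The empty walk links every vertex to itself, so unlinked sets are disjoint. *)
  have AB a b : a \in A -> b \in B -> a != b.
    move=> aA' bB'; apply: contraNneq (nAB a b aA' bB') => ->.
    by apply/existsP; exists v0; apply: connect0.
  by rewrite /s /=; case: (odd i) => /=; apply/eqP => -[h1 h2];
     [have := AB _ _ aA1 bB; rewrite h1 eqxx|have := AB _ _ aA bB1; rewrite h1 eqxx].
move=> y; apply: leq_trans D0; apply/card_le1_eqP => i j; rewrite !inE.
move=> /eqP <- /eqP/eqP; rewrite nth_uniq ?szp ?(ltnW (ltP _)) //.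
by move/eqP/val_inj.
Qed.

(* r_hat_2(P^(3)_n) <= C n, unfolded: there is a 3-uniform hypergraph G with
   at most C n edges and G -> (P^(3)_n)_2. *)
Theorem theorem1p1 :
  exists C : nat, 0 < C /\
    forall n : nat, 0 < n ->
      exists (V : finType) (E : {set {set V}}),
        uniform3 E /\ #|E| <= C * n /\ arrows_tight_path E 2 n.
Proof.
have [k Hk] := expander; pose D := (k + k * k).+1.
have [t Ht] := clean D (ltn0Sn (D * D * D)).
(* There are [8 * n] cells, each with at most [D * t] points in its blow-up and hence at most 2^(Dt)
   edges. *)
exists (8 * 2 ^ (D * t)); split; first by rewrite muln_gt0 expn_gt0.
move=> n n0; have [e [G [sym_e deg cardG expand]]] := Hk n n0.
have cellD y : #|ball2 e y| <= D by apply/leqW/card_ball2.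
pose host z := powerset (setX (ball2 e z) [set: 'I_t]).
exists ('I_(8 * n) * 'I_t)%type.
exists [set f : {set 'I_(8 * n) * 'I_t} |
  (#|f| == 3) && [exists z, f \in host z]]; split; [|split].
- by move=> f; rewrite inE => /andP[/eqP].
- have -> : 8 * 2 ^ (D * t) * n = #|[set: 'I_(8 * n)]| * 2 ^ (D * t).
    by rewrite cardsT card_ord mulnAC.
  apply: (card_cover_leq (F := host)) => [z _|f].
    rewrite card_powerset cardsX cardsT card_ord leq_pexp2l //.
    by rewrite leq_mul2r cellD orbT.
  by rewrite inE => /andP[_ /existsP[z fz]]; exists z.
move=> col; pose c f := col f == ord0.
have [||S [chi [uniqS sizeS hom]]] := Ht _ (ball2 e) c.
- by [].
- move=> v; apply: leq_trans (cellD v); apply/subset_leq_card/subsetP => y.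
  by rewrite inE ball2_sym.
have [b [f [f_inj f_col]]] :=
  arrow_core n0 (ltn0Sn _) sym_e cellD cardG expand uniqS sizeS hom.
exists f; split; [split=> // i lti|].
  have [_ [x [x0 x1 x2]]] := f_col i lti.
  rewrite inE; apply/andP; split.
    have lti1 := ltnW lti; have lti0 := ltnW lti1.
    have neq j l : j < n -> l < n -> j < l -> f j != f l.
      move=> ltj ltl ltjl; apply: contraTneq ltjl => /(f_inj _ _ ltj ltl) ->.
      by rewrite ltnn.
    by rewrite -setUA cardsU1 cards2 !inE negb_or !neq.
  apply/existsP; exists x; rewrite powersetE; apply/subsetP => y.
  by rewrite !inE andbT -orbA => /or3P[]/eqP->;
    [move: x0|move: x1|move: x2]; rewrite inE.
exists (if b then ord0 else ord_max) => i /f_col[<- _]; rewrite /c.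
by case: (altP eqP) => [//|]; case: (col _) => -[|[|]] // lt h; apply/val_inj.
Qed.
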